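(* Let $\vdash$ be a logic with a partition function and a set of inconsistency terms. For every directed system $X$ of matrices in $\mathsf{Mod}^{\mathrm{Su}}(\vdash)$, the following are equivalent: (i) $\mathrm{PL}(X)\in\mathsf{Mod}^{\mathrm{Su}}(\vdash^{l})$; (ii) at most one of the matrices $\langle\mathbf{A}_i,F_i\rangle$ of $X$ is trivial (i.e. satisfies $F_i=A_i$).
   Context: Fix an algebraic language without constant symbols; $\mathrm{Var}(\varphi)$ is the set of variables of $\varphi$. A logic is a substitution-invariant consequence relation. The left variable inclusion companion: $\Gamma\vdash^{l}\varphi$ iff there is $\Gamma'\subseteq\Gamma$ with $\bigcup_{\gamma\in\Gamma'}\mathrm{Var}(\gamma)\subseteq\mathrm{Var}(\varphi)$ and $\Gamma'\vdash\varphi$. A matrix $\langle\mathbf{A},F\rangle$ is a model of a logic if $\Gamma\vdash\varphi$ and $h[\Gamma]\subseteq F$ (homomorphism $h$ from the formula algebra) imply $h(\varphi)\in F$; $F$ is then a filter. $\Omega^{\mathbf{A}}F$ is the largest congruence compatible with $F$; the Suszko congruence w.r.t. a logic is the intersection of $\Omega^{\mathbf{A}}G$ over filters $G\supseteq F$ of that logic; $\mathsf{Mod}^{\mathrm{Su}}(\vdash)$ is the class of models of $\vdash$ with identity Suszko congruence and $\mathrm{Alg}(\vdash)$ the class of their algebraic reducts. A set of formulas $\Sigma$ is a set of inconsistency terms for $\vdash$ if $\sigma[\Sigma]\vdash\varphi$ for every substitution $\sigma$ and formula $\varphi$. A binary operation $\cdot$ is a partition function on $\mathbf{A}$ if for all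 $a,b,c$ and basic operations $g$ of arity $n\ge1$: $a\cdot a=a$; $a\cdot(b\cdot c)=(a\cdot b)\cdot c$; $a\cdot(b\cdot c)=a\cdot(c\cdot b)$; $g(a_1,\dots,a_n)\cdot b=g(a_1\cdot b,\dots,a_n\cdot b)$; $b\cdot g(a_1,\dots,a_n)=b\cdot a_1\cdot\ldots\cdot a_n$; $\vdash$ has a partition function if some formula $x\cdot y$ in which both $x,y$ occur satisfies $x\vdash x\cdot y$ and is a partition function on every $\mathbf{A}\in\mathrm{Alg}(\vdash)$. A directed system of matrices $X$: semilattice $\langle I,\vee\rangle$ (order $i\le j$ iff $i\vee j=j$), matrices $\langle\mathbf{A}_i,F_i\rangle$ ($i\in I$) with pairwise disjoint universes, homomorphisms $f_{ij}\colon\mathbf{A}_i\to\mathbf{A}_j$ ($i\le j$) with $f_{ij}[F_i]\subseteq F_j$, $f_{ii}=\mathrm{id}$, $f_{ik}=f_{jk}\circ f_{ij}$; its Płonka sum $\mathrm{PL}(X)$ is $\langle\mathbf{A},\bigcup_iF_i\rangle$, $\mathbf{A}$ with universe $\bigcup_iA_i$ and $f^{\mathbf{A}}(a_1,\dots,a_n)=f^{\mathbf{A}_j}(f_{i_1j}(a_1),\dots,f_{i_nj}(a_n))$ for $a_k\in A_{i_k}$, $j=i_1\vee\dots\vee i_n$. *)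

(* Defs.v *)
From Stdlib Require Import Relations.
From HB Require Import structures.
From mathcomp Require Import all_boot all_order.
From mathcomp Require Import boolp classical_sets.

Set Implicit Arguments.
Unset Strict Implicit.
Unset Printing Implicit Defensive.

Import Order.TTheory.
Local Open Scope classical_set_scope.

(* All arities are positive: there are no constant symbols. *)
Record signature := Signature {
  op : Type;
  arity : op -> nat;
  arity_gt0 : forall g, 0 < arity g }.

Record algebra (L : signature) := Algebra {
  carrier :> Type;
  carrier_nonempty : inhabited carrier;
  opA : forall g : op L, ('I_(arity g) -> carrier) -> carrier }.

Arguments opA {L} a g _.

Definition is_hom (L : signature) (A B : algebra L) (h : A -> B) : Prop :=
  forall (g : op L) (a : 'I_(arity g) -> A),
    h (opA A g a) = opA B g (fun k => h (a k)).

Inductive formula (L : signature) : Type :=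
| Var of nat
| App (g : op L) of ('I_(arity g) -> formula L).

Arguments Var {L} _.
Arguments App {L} g _.

Fixpoint vars (L : signature) (phi : formula L) : set nat :=
  match phi with
  | Var n => [set n]
  | App g t => \bigcup_(k in setT) vars (t k)
  end.

Definition Fm (L : signature) : algebra L :=
  Algebra (inhabits (Var 0)) (@App L).

Fixpoint eval (L : signature) (A : algebra L) (v : nat -> A)
    (phi : formula L) : A :=
  match phi with
  | Var n => v n
  | App g t => opA A g (fun k => eval v (t k))
  end.

(* Monotonicity of the consequence relation follows from entails_refl and
   entails_cut. *)
Record logic (L : signature) := Logic {
  entails :> set (formula L) -> formula L -> Prop;
  entails_refl : forall (G : set (formula L)) phi, G phi -> entails G phi;
  entails_cut : forall (G D : set (formula L)) phi,
    (forall psi, D psi -> entails G psi) -> entails D phi -> entails G phi;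
  entails_subst : forall s : Fm L -> Fm L, is_hom s ->
    forall (G : set (formula L)) phi,
      entails G phi -> entails (s @` G) (s phi) }.

Section LeftCompanion.
Variables (L : signature) (l : logic L).

Definition left_entails (G : set (formula L)) (phi : formula L) : Prop :=
  exists G' : set (formula L),
    [/\ G' `<=` G, \bigcup_(psi in G') vars psi `<=` vars phi & l G' phi].

Lemma left_entails_refl (G : set (formula L)) phi :
  G phi -> left_entails G phi.
Proof.
move=> Gphi; exists [set phi]; split.
- by move=> _ ->.
- by move=> n [_ ->].
- exact: entails_refl.
Qed.

Lemma left_entails_cut (G D : set (formula L)) phi :
  (forall psi, D psi -> left_entails G psi) ->
  left_entails D phi -> left_entails G phi.
Proof.
move=> GD [D' [D'D varD' D'phi]].
exists [set psi | G psi /\ vars psi `<=` vars phi]; split.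
- by move=> psi [].
- by move=> n [psi [_ H] /H].
- apply: entails_cut D'phi => psi D'psi.
  have [G' [G'G varG' G'psi]] := GD _ (D'D _ D'psi).
  apply: entails_cut G'psi => chi G'chi; apply: entails_refl; split.
    exact: G'G.
  move=> n chin; apply: varD'; exists psi => //.
  by apply: varG'; exists chi.
Qed.

Lemma vars_subst (s : Fm L -> Fm L) (phi : formula L) : is_hom s ->
  vars (s phi) = \bigcup_(n in vars phi) vars (s (Var n)).
Proof.
move=> hs; elim: phi => [n|g t IH].
  by rewrite bigcup_set1.
have -> : s (App g t) = App g (fun k => s (t k)) by exact: hs g t.
apply/seteqP; split=> m /=.
- case=> k _; rewrite IH => -[n tn nm]; exists n => //; by exists k.
- case=> n [k _ tn] nm; exists k => //; rewrite IH; by exists n.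
Qed.

Lemma left_entails_subst (s : Fm L -> Fm L) : is_hom s ->
  forall (G : set (formula L)) phi,
    left_entails G phi -> left_entails (s @` G) (s phi).
Proof.
move=> hs G phi [G' [G'G varG' G'phi]]; exists (s @` G'); split.
- exact: image_subset.
- move=> m [_ [psi G'psi <-]]; rewrite !vars_subst // => -[n psin nm].
  by exists n => //; apply: varG'; exists psi.
- exact: entails_subst.
Qed.

Definition left_companion : logic L :=
  Logic left_entails_refl left_entails_cut left_entails_subst.

End LeftCompanion.

Definition inconsistency_terms (L : signature) (l : logic L)
    (Sigma : set (formula L)) : Prop :=
  forall s : Fm L -> Fm L, is_hom s ->
  forall phi : formula L, l (s @` Sigma) phi.

Definition has_inconsistency_terms (L : signature) (l : logic L) : Prop :=
  exists Sigma : set (formula L), inconsistency_terms l Sigma.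

Record matrix (L : signature) := Matrix {
  malg :> algebra L;
  filt : set malg }.

Arguments filt {L} m _.

Definition trivial_matrix (L : signature) (M : matrix L) : Prop :=
  filt M = setT.

Definition is_filter (L : signature) (l : logic L) (A : algebra L)
    (F : set A) : Prop :=
  forall (G : set (formula L)) (phi : formula L), l G phi ->
  forall h : Fm L -> A, is_hom h -> h @` G `<=` F -> F (h phi).

Definition is_model (L : signature) (l : logic L) (M : matrix L) : Prop :=
  is_filter l (filt M).

Record congruence (L : signature) (A : algebra L) (R : A -> A -> Prop) :
    Prop := Congruence {
  cong_refl : forall a, R a a;
  cong_sym : forall a b, R a b -> R b a;
  cong_trans : forall a b c, R a b -> R b c -> R a c;
  cong_op : forall (g : op L) (a b : 'I_(arity g) -> A),
    (forall k, R (a k) (b k)) -> R (opA A g a) (opA A g b) }.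

Definition compatible (L : signature) (A : algebra L) (F : set A)
    (R : A -> A -> Prop) : Prop :=
  forall a b, R a b -> F a -> F b.

(* The union of all congruences compatible with F; it is the largest one by
   leibniz_cong, leibniz_compat and leibniz_max below. *)
Definition leibniz (L : signature) (A : algebra L) (F : set A) (a b : A) :
    Prop :=
  exists R : A -> A -> Prop, [/\ congruence R, compatible F R & R a b].

Section Leibniz.
Variables (L : signature) (A : algebra L) (F : set A).

Lemma leibniz_max (R : A -> A -> Prop) :
  congruence R -> compatible F R -> forall a b, R a b -> leibniz F a b.
Proof. by move=> cR fR a b ab; exists R. Qed.

Lemma leibniz_compat : compatible F (leibniz F).
Proof. by move=> a b [R [_ fR ab]]; exact: fR ab. Qed.

Let T := clos_refl_trans A (leibniz F).

Let upd (g : op L) (a : 'I_(arity g) -> A) k x : 'I_(arity g) -> A :=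
  fun j => if j == k then x else a j.

Let T_upd (g : op L) (a : 'I_(arity g) -> A) k x y :
  T x y -> T (opA A g (upd a k x)) (opA A g (upd a k y)).
Proof.
elim=> {x y} [x y [R [cR fR xy]]|x|x y z _ IH1 _ IH2].
- apply: rt_step; exists R; split=> //; apply: (cong_op cR) => j.
  by rewrite /upd; case: eqP => // _; exact: (cong_refl cR).
- exact: rt_refl.
- exact: rt_trans IH1 IH2.
Qed.

Let T_op (g : op L) (a b : 'I_(arity g) -> A) :
  (forall k, T (a k) (b k)) -> T (opA A g a) (opA A g b).
Proof.
move=> ab; pose c m : 'I_(arity g) -> A := fun k => if k < m then b k else a k.
have H m : T (opA A g a) (opA A g (c m)).
  elim: m => [|m IH].
    by have -> : c 0 = a by []; exact: rt_refl.
  apply: rt_trans IH _; case: (ltnP m (arity g)) => hm; last first.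
    suff -> : c m.+1 = c m by exact: rt_refl.
    apply/funext => k; rewrite /c.
    by rewrite (leq_trans (ltn_ord k) hm) (leq_trans (ltn_ord k) (leqW hm)).
  pose k := Ordinal hm.
  have -> : c m = upd (c m) k (a k).
    apply/funext => j; rewrite /upd; case: eqP => // ->.
    by rewrite /c /= ltnn.
  have -> : c m.+1 = upd (c m) k (b k).
    apply/funext => j; rewrite /upd /c; case: eqP => [->|/eqP jk] /=.
      by rewrite ltnSn.
    by rewrite ltnS leq_eqVlt -[_ == m]/(j == k) (negPf jk).
  exact: T_upd.
have := H (arity g); suff -> : c (arity g) = b by [].
by apply/funext => k; rewrite /c ltn_ord.
Qed.

Let T_cong : congruence T.
Proof.
split.
- exact: rt_refl.
- move=> a b; elim=> {a b} [a b [R [cR fR ab]]|a|a b c _ IH1 _ IH2].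
  + by apply: rt_step; exists R; split=> //; exact: (cong_sym cR).
  + exact: rt_refl.
  + exact: rt_trans IH2 IH1.
- exact: rt_trans.
- exact: T_op.
Qed.

Let T_compat : compatible F T.
Proof.
move=> a b; elim=> {a b} [a b|//|a b c _ IH1 _ IH2 /IH1/IH2//].
exact: leibniz_compat.
Qed.

Lemma leibniz_cong : congruence (leibniz F).
Proof.
have TE : T = leibniz F.
  apply/funext => a; apply/funext => b; apply/propext; split.
    exact: leibniz_max.
  exact: rt_step.
by rewrite -TE.
Qed.

End Leibniz.

Definition suszko (L : signature) (l : logic L) (A : algebra L) (F : set A)
    (a b : A) : Prop :=
  forall G : set A, is_filter l G -> F `<=` G -> leibniz G a b.

Definition ModSu (L : signature) (l : logic L) (M : matrix L) : Prop :=
  is_model l M /\ forall a b : M, suszko l (filt M) a b <-> a = b.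

Definition Alg (L : signature) (l : logic L) (A : algebra L) : Prop :=
  exists F : set A, ModSu l (Matrix F).

Record partition_function (L : signature) (A : algebra L)
    (dot : A -> A -> A) : Prop := PartitionFunction {
  pf_idem : forall a, dot a a = a;
  pf_assoc : forall a b c, dot a (dot b c) = dot (dot a b) c;
  pf_comm : forall a b c, dot a (dot b c) = dot a (dot c b);
  pf_opl : forall (g : op L) (a : 'I_(arity g) -> A) b,
    dot (opA A g a) b = opA A g (fun k => dot (a k) b);
  pf_opr : forall (g : op L) (a : 'I_(arity g) -> A) b,
    dot b (opA A g a) = foldl dot b [seq a k | k <- enum 'I_(arity g)] }.

(* The formula t(x, y) with x = Var 0 and y = Var 1, as a binary operation. *)
Definition term_op2 (L : signature) (A : algebra L) (t : formula L)
    (a b : A) : A :=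
  eval (fun n => if n is 0 then a else b) t.

Definition has_partition_function (L : signature) (l : logic L) : Prop :=
  exists t : formula L,
    [/\ vars t = [set 0; 1],
        l [set Var 0] t
      & forall A : algebra L, Alg l A -> partition_function (@term_op2 L A t)].

(* The universes of the summands are only required to be types indexed by I;
   they are made disjoint by tagging when the sum is formed. *)
Record directed_system (L : signature) (d : Order.disp_t)
    (I : joinSemilatticeType d) := DirectedSystem {
  ds_index_nonempty : inhabited I;
  ds_matrix :> I -> matrix L;
  ds_map : forall i j : I, (i <= j)%O -> ds_matrix i -> ds_matrix j;
  ds_map_hom : forall (i j : I) (ij : (i <= j)%O), is_hom (ds_map ij);
  ds_map_filt : forall (i j : I) (ij : (i <= j)%O),
    ds_map ij @` filt (ds_matrix i) `<=` filt (ds_matrix j);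
  ds_map_id : forall (i : I) (ii : (i <= i)%O) (a : ds_matrix i),
    ds_map ii a = a;
  ds_map_comp : forall (i j k : I) (ij : (i <= j)%O) (jk : (j <= k)%O)
    (ik : (i <= k)%O) (a : ds_matrix i),
    ds_map ik a = ds_map jk (ds_map ij a) }.

Arguments ds_map {L d I} _ {i j} ij _.

Section PlonkaSum.
Variables (L : signature) (d : Order.disp_t) (I : joinSemilatticeType d).

(* I need not have a bottom element, so the fold starts at the first index. *)
Definition joins (g : op L) (i : 'I_(arity g) -> I) : I :=
  foldr Order.join (i (Ordinal (arity_gt0 g)))
    [seq i k | k <- enum 'I_(arity g)].

Lemma le_joins (g : op L) (i : 'I_(arity g) -> I) k : (i k <= joins i)%O.
Proof.
rewrite /joins; have : k \in enum 'I_(arity g) by rewrite mem_enum.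
elim: (enum _) => //= k' s IH; rewrite inE => /orP[/eqP->|/IH le].
  exact: leUl.
by apply: le_trans le (leUr _ _).
Qed.

Variable X : directed_system L I.

Definition plonka_op (g : op L) (a : 'I_(arity g) -> {i : I & X i}) :
    {i : I & X i} :=
  let i k := tag (a k) in
  Tagged (fun i => X i : Type)
    (opA (X (joins i)) g (fun k => ds_map X (le_joins i k) (tagged (a k)))).

Lemma plonka_nonempty : inhabited {i : I & X i}.
Proof.
case: (ds_index_nonempty X) => i; case: (carrier_nonempty (X i)) => a.
by constructor; exists i.
Qed.

Definition plonka_algebra : algebra L := Algebra plonka_nonempty plonka_op.

Definition plonka : matrix L :=
  @Matrix L plonka_algebra [set a | filt (X (tag a)) (tagged a)].

End PlonkaSum.

(* Main.v *)
(** Every family of filters of the summands that is preserved by the transition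
maps gives a filter of [left_companion l] on the Płonka sum.  For a filter [G] of
a single summand [X i], the family with [k]-th member the preimage of [G] in
[X k] if [k <= i], and all of [X k] otherwise, is the main tool.

If [a : X i] and [b : X j] are Suszko-congruent in the sum, then:
- for [i = j] these filters show that [a] and [b] are Suszko-congruent in [X i];
- for [~ j <= i], let [G] be the filter of [X i] itself.  For every [c : X i] the
  elements [c . a] and [c . b] are congruent, and [c . b] lies outside the
  summands below [i], so [c . a] is in [G].  As [c |-> c . a] is an endomorphism
  of [X i], the inconsistency terms force [X i] to be trivial.

By inconsistency terms again, every summand above a trivial one is trivial. So two
congruent elements of different summands produce two trivial summands, and
conversely all elements above a trivial summand are Suszko-congruent. *)

Require Import Defs.
From mathcomp Require Import all_boot all_order.
From mathcomp Require Import boolp classical_sets.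

Set Implicit Arguments.
Unset Strict Implicit.
Unset Printing Implicit Defensive.

Import Order.TTheory.
Local Open Scope classical_set_scope.

Section Homomorphisms.
Variable L : signature.

Lemma eval_hom (A : algebra L) (v : nat -> A) : @is_hom L (Fm L) A (eval v).
Proof. by []. Qed.

Lemma hom_eval (A B : algebra L) (f : A -> B) (v : nat -> A) phi :
  is_hom f -> f (eval v phi) = eval (f \o v) phi.
Proof.
move=> hf; elim: phi => //= g t IH.
by rewrite hf; congr (opA B g _); apply/funext => k.
Qed.

Lemma is_hom_comp (A B C : algebra L) (f : A -> B) (g : B -> C) :
  is_hom f -> is_hom g -> is_hom (g \o f).
Proof. by move=> hf hg p a /=; rewrite hf hg. Qed.

Lemma cong_eval (A : algebra L) (R : A -> A -> Prop) (v w : nat -> A) phi :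
  congruence R -> (forall n, R (v n) (w n)) -> R (eval v phi) (eval w phi).
Proof.
by move=> cR vw; elim: phi => [n|g t IH] /=; [exact: vw|exact: (cong_op cR)].
Qed.

Lemma term_op2_hom (A B : algebra L) (f : A -> B) (t : formula L) a b :
  is_hom f -> f (term_op2 t a b) = term_op2 t (f a) (f b).
Proof.
move=> hf; rewrite /term_op2 hom_eval //; congr (eval _ t).
by apply/funext => -[].
Qed.

Lemma is_filter_preimage (l : logic L) (A B : algebra L) (f : A -> B)
    (G : set B) :
  is_hom f -> is_filter l G -> is_filter l (f @^-1` G).
Proof.
move=> hf fG D phi Dphi h hh hD; apply: (fG _ _ Dphi _ (is_hom_comp hh hf)).
by move=> _ [psi Dpsi <-]; apply: hD; exists psi.
Qed.

(** With all variables identified, inconsistency terms evaluated at [e a0] are values of [e], hence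
    designated; they entail a fresh variable, which may take any value [y]. *)
Lemma trivial_matrix_hom (l : logic L) (A : algebra L) (M : matrix L)
    (e : A -> M) :
  has_inconsistency_terms l -> is_model l M -> is_hom e ->
  (forall a, filt M (e a)) -> trivial_matrix M.
Proof.
move=> [S hS] hM he eF; apply/seteqP; split=> // y _.
have [a0] := carrier_nonempty A.
pose s : Fm L -> Fm L := eval (fun _ => Var 0 : Fm L).
pose w n : M := if n is 0 then e a0 else y.
have := hM _ _ (hS s (eval_hom _) (Var 1)) _ (eval_hom w); apply.
move=> _ [_ [psi _ <-] <-].
rewrite /s (@hom_eval (Fm L) M (eval w) _ psi (@eval_hom M w)).
by rewrite -[_ \o _]/(e \o (fun=> a0)) -hom_eval.
Qed.

End Homomorphisms.

Section PlonkaSums.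
Variables (L : signature) (d : Order.disp_t) (I : joinSemilatticeType d).
Variable X : directed_system L I.
Implicit Types (i j m : I).

Local Notation PL := (plonka_algebra X).

Definition summand i (a : X i) : PL := Tagged (fun i => X i : Type) a.

Lemma joins_le (g : op L) (f : 'I_(arity g) -> I) m :
  (forall k, f k <= m)%O -> (joins f <= m)%O.
Proof.
move=> fm; rewrite /joins; elim: (enum _) => //= k s IH.
by rewrite leUx fm IH.
Qed.

Lemma summand_ds_map (u : PL) m (p : (tag u <= m)%O) :
  tag u = m -> summand (ds_map X p (tagged u)) = u.
Proof. by case: u p => k a /= p e; subst m; rewrite ds_map_id. Qed.

Lemma summand_hom i : is_hom (@summand i).
Proof.
move=> g a; pose u := opA PL g (fun k => summand (a k)).
(* The join of the constant family [i] is only provably equal to [i], so [u] is carried into [X i]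
   by a transition map. *)
have le : (tag u <= i)%O by exact: joins_le.
have e : tag u = i.
  apply: le_anti; rewrite le /=.
  exact: (Defs.le_joins (fun=> i) (Ordinal (arity_gt0 g))).
rewrite -[RHS](summand_ds_map le e) [tagged u]/= ds_map_hom.
congr (summand (opA _ g _)); apply/funext => k.
by rewrite -(ds_map_comp _ _ (lexx i)) ds_map_id.
Qed.

Lemma tag_eval_ge (v : nat -> PL) (phi : formula L) n :
  vars phi n -> (tag (v n) <= tag (eval v phi))%O.
Proof.
elim: phi => [m -> //|g t IH] [k _ /IH le]; apply: le_trans le _.
exact: (Defs.le_joins (fun k => tag (eval v (t k)))).
Qed.

Lemma tag_eval_le (v : nat -> PL) (phi : formula L) m :
  (forall n, vars phi n -> tag (v n) <= m)%O -> (tag (eval v phi) <= m)%O.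
Proof.
elim: phi => [n le|g t IH le] /=; first exact: le.
by apply: joins_le => k; apply: IH => n tn; apply: le; exists k.
Qed.

Lemma ds_map_eval (v : nat -> PL) (phi : formula L) m (w : nat -> X m)
    (p : (tag (eval v phi) <= m)%O) :
  (forall n (q : (tag (v n) <= m)%O), w n = ds_map X q (tagged (v n))) ->
  ds_map X p (tagged (eval v phi)) = eval w phi.
Proof.
move=> vw; elim: phi p => [n|g t IH] p /=; first by rewrite -vw.
rewrite ds_map_hom; congr (opA _ g _); apply/funext => k.
have q : (tag (eval v (t k)) <= m)%O.
  exact: le_trans (Defs.le_joins (fun k => tag (eval v (t k))) k) p.
by rewrite -(ds_map_comp _ _ q) IH.
Qed.

(** Variable inclusion puts the values of the premises in [D'] at or below the summand of the
    conclusion; pushed into that summand, they satisfy [D'] there, and the filter [H m] applies. *)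
Lemma plonka_filter (l : logic L) (H : forall k, set (X k)) :
  (forall k, is_filter l (H k)) ->
  (forall k m (p : (k <= m)%O) a, H k a -> H m (ds_map X p a)) ->
  @is_filter L (left_companion l) PL [set u | H (tag u) (tagged u)].
Proof.
move=> fH mapH D phi [D' [D'D varD' D'phi]] h hh hD.
pose v n := h (Var n).
have hE psi : h psi = eval v psi.
  elim: psi => //= g t IH; rewrite -[App g t]/(opA (Fm L) g t) hh.
  by congr (plonka_op _); apply/funext.
set m := tag (h phi).
have [w vw] : exists w : nat -> X m, forall n (q : (tag (v n) <= m)%O),
    w n = ds_map X q (tagged (v n)).
  suff /choice[w vw] : forall n, exists x : X m, forall q : (tag (v n) <= m)%O,
      x = ds_map X q (tagged (v n)) by exists w.
  move=> n.
  (* A variable whose value is not below [m] does not occur in [phi], so an arbitrary default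
     serves. *)
  have [q|nq] := pselect (tag (v n) <= m)%O; last first.
    by have [x] := carrier_nonempty (X m); exists x => q; case: nq.
  by exists (ds_map X q (tagged (v n))) => q'; rewrite (bool_irrelevance q q').
have wE psi (p : (tag (h psi) <= m)%O) :
    ds_map X p (tagged (h psi)) = eval w psi.
  by move: p; rewrite hE => p; exact: ds_map_eval.
rewrite /= -(ds_map_id (lexx m) (tagged (h phi))) wE.
apply: (fH m _ _ D'phi _ (eval_hom w)) => _ [psi D'psi <-].
have p : (tag (h psi) <= m)%O.
  rewrite hE; apply: tag_eval_le => n psin; rewrite /m hE; apply: tag_eval_ge.
  by apply: varD'; exists psi.
by rewrite -(wE _ p); apply: mapH; apply: hD; exists psi => //; exact: D'D.
Qed.

Lemma plonka_model (l : logic L) :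
  (forall i, is_model l (X i)) -> is_model (left_companion l) (plonka X).
Proof.
move=> hX; apply: (@plonka_filter l (fun k => filt (X k)) hX).
by move=> k m p a Fa; apply: (ds_map_filt (ij := p)); exists a.
Qed.

(** Quantifying over [p] makes membership vacuous outside the summands below [i]. *)
Definition filter_below i (G : set (X i)) : set PL :=
  [set u | forall p : (tag u <= i)%O, G (ds_map X p (tagged u))].

Lemma filter_below_summand i (G : set (X i)) (a : X i) :
  filter_below G (summand a) <-> G a.
Proof.
split=> [/(_ (lexx i))|Ga p]; first by rewrite ds_map_id.
by rewrite ds_map_id.
Qed.

Lemma filter_below_filter (l : logic L) i (G : set (X i)) :
  is_filter l G -> is_filter (left_companion l) (filter_below G).
Proof.
move=> fG; apply: (@plonka_filter l (fun k => [set a |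
  forall p : (k <= i)%O, G (ds_map X p a)])).
  move=> k D phi Dphi h hh hD /= p.
  apply: (is_filter_preimage (@ds_map_hom _ _ _ X _ _ p) fG Dphi hh).
  by move=> _ [psi Dpsi <-]; apply: hD; exists psi.
move=> k m p a Ga q; have r : (k <= i)%O := le_trans p q.
by rewrite -(ds_map_comp p q r).
Qed.

Lemma filter_below_sup i (G : set (X i)) :
  filt (X i) `<=` G -> filt (plonka X) `<=` filter_below G.
Proof.
by move=> FG u Fu p; apply/FG/(ds_map_filt (ij := p)); exists (tagged u).
Qed.

Lemma suszko_summand (l : logic L) i (a b : X i) :
  suszko (left_companion l) (filt (plonka X)) (summand a) (summand b) ->
  suszko l (filt (X i)) a b.
Proof.
move=> ab G fG FG.
have ab' := ab _ (filter_below_filter fG) (filter_below_sup FG).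
have cR := leibniz_cong (filter_below G).
(* The Leibniz congruence of the sum, restricted to [X i], is compatible with [G] because
   [filter_below G] meets [X i] in [G]. *)
exists (fun x y => leibniz (filter_below G) (summand x) (summand y)).
split=> //.
  split=> [x|x y|x y z|g x y xy].
  - exact: cong_refl cR _.
  - exact: cong_sym cR _ _.
  - exact: cong_trans cR _ _ _.
  - by rewrite !summand_hom; exact: cong_op cR _ _ _ xy.
move=> x y /leibniz_compat xy /filter_below_summand/xy.
by move/filter_below_summand.
Qed.

Lemma trivial_up (l : logic L) i j :
  has_inconsistency_terms l -> is_model l (X j) -> (i <= j)%O ->
  trivial_matrix (X i) -> trivial_matrix (X j).
Proof.
move=> hit hXj ij ti; apply: (trivial_matrix_hom hit hXj (@ds_map_hom _ _ _ X _ _ ij)).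
by move=> a; apply: (ds_map_filt (ij := ij)); exists a => //; rewrite ti.
Qed.

Lemma suszko_trivial (l : logic L) i (a : X i) (b : PL) :
  has_partition_function l -> has_inconsistency_terms l -> ModSu l (X i) ->
  suszko (left_companion l) (filt (plonka X)) (summand a) b ->
  ~~ (tag b <= i)%O -> trivial_matrix (X i).
Proof.
move=> [t [vt _ pft]] hit hXi ab nbi.
have Alg_i : Alg l (X i) by exists (filt (X i)).
have opl := pf_opl (pft _ Alg_i).
apply: (@trivial_matrix_hom _ _ (X i) _ (fun c => term_op2 t c a) hit hXi.1)
  => [g c|c].
  exact: opl.
apply/filter_below_summand; rewrite (term_op2_hom _ _ _ (@summand_hom i)).
have cR := leibniz_cong (filter_below (filt (X i))).
have ba := cong_sym cR
  (ab _ (filter_below_filter hXi.1) (filter_below_sup (@subset_refl _ _))).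
have cba : leibniz (filter_below (filt (X i)))
    (term_op2 (A := PL) t (summand c) b) (term_op2 t (summand c) (summand a)).
  by apply: cong_eval => // -[|n] //; exact: cong_refl cR _.
apply: (leibniz_compat cba).
(* As [Var 1] occurs in [t], the index of [c . b] is above that of [b], so it cannot be below
   [i]. *)
move=> p; case/negP: nbi; apply: le_trans p.
rewrite /term_op2; set v := (fun n : nat => _ : PL).
by apply: (@tag_eval_ge v t 1); rewrite vt; right.
Qed.

Lemma suszko_above_trivial (l : logic L) i (a b : PL) :
  has_inconsistency_terms l -> (forall k, is_model l (X k)) ->
  trivial_matrix (X i) -> (i <= tag a)%O -> (i <= tag b)%O ->
  suszko (left_companion l) (filt (plonka X)) a b.
Proof.
move=> hit hX ti ia ib G fG FG.
(* This collapses everything above [i] to one class. One argument in that class forces the value of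
   an operation into it, and every filter above that of the sum contains the class. *)
exists (fun x y => x = y \/ (i <= tag x)%O /\ (i <= tag y)%O); split; last 1 first.
- by right.
- split=> [x|x y [->|[]]|x y z [->//|[ix iy]] [<-|[_ iz]]|g x y xy].
  + by left.
  + by left.
  + by right.
  + by right.
  + by right.
  have [eqxy|/existsNP[k nk]] := pselect (forall k, x k = y k).
    by left; congr (opA PL g _); apply/funext.
  right; have [//|[ix iy]] := xy k; split.
  + exact: le_trans ix (Defs.le_joins (fun k => tag (x k)) k).
  + exact: le_trans iy (Defs.le_joins (fun k => tag (y k)) k).
- move=> x y [<-//|[_ iy]] _; apply: FG => /=.
  by rewrite (trivial_up hit (hX _) iy ti).
Qed.

End PlonkaSums.

Theorem theorem5p11 (L : signature) (l : logic L)
    (hpf : has_partition_function l) (hit : has_inconsistency_terms l)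
    (d : Order.disp_t) (I : joinSemilatticeType d) (X : directed_system L I)
    (hX : forall i : I, ModSu l (X i)) :
  ModSu (left_companion l) (plonka X) <->
  (forall i j : I,
     trivial_matrix (X i) -> trivial_matrix (X j) -> i = j).
Proof.
have hM k : is_model l (X k) := (hX k).1.
split=> [[_ red] i j ti tj|uniq_triv].
  (* The index of a trivial summand is maximal, so [i] and [j] both equal their join. *)
  have top k m : trivial_matrix (X k) -> (k <= m)%O -> k = m.
    move=> tk km; have [a] := carrier_nonempty (X k).
    have [b] := carrier_nonempty (X m).
    have /red/(congr1 (@tag _ _)) // :=
      @suszko_above_trivial _ _ _ X l k (summand a) (summand b)
        hit hM tk (lexx k) km.
  by rewrite (top _ _ ti (leUl i j)) {2}(top _ _ tj (leUr j i)).
split; first exact: plonka_model.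
move=> u v; split=> [uv|-> G _ _]; last exact: cong_refl (leibniz_cong _) _.
have vu : suszko (left_companion l) (filt (plonka X)) v u.
  by move=> G fG FG; apply: cong_sym (leibniz_cong _) _ _ (uv G fG FG).
case: u v uv vu => [i a] [j b] uv vu.
have triv_i : ~~ (j <= i)%O -> trivial_matrix (X i).
  exact: suszko_trivial hpf hit (hX i) uv.
have triv_j : ~~ (i <= j)%O -> trivial_matrix (X j).
  exact: suszko_trivial hpf hit (hX j) vu.
(* Each failed comparison makes one summand trivial; if the other comparison holds, triviality
   passes up to the second one. *)
have eij : i = j.
  have [ij|nij] := boolP (i <= j)%O; have [ji|nji] := boolP (j <= i)%O.
  - by apply: le_anti; rewrite ij ji.
  - by apply: uniq_triv (triv_i nji) (trivial_up hit (hM j) ij (triv_i nji)).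
  - by apply: uniq_triv (trivial_up hit (hM i) ji (triv_j nij)) (triv_j nij).
  - exact: uniq_triv (triv_i nji) (triv_j nij).
subst j.
by rewrite (proj1 ((hX i).2 a b) (suszko_summand uv)).
Qed.
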